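(* Let $n\ge 2$. The flat unrestricted braid group $FU_n$ has the following reduced presentation, with generators $c_1, v_1,\ldots,v_{n-1}$ (the elements of $FU_n$ of the same names) and defining relations: $$\begin{array}{l} v_i v_{i+1} v_i = v_{i+1} v_i v_{i+1},\\ v_i v_j = v_j v_i,\quad j\neq i\pm 1,\\ c_1^2=1,\quad v_i^2 = 1,\quad 1\le i\le n-1,\\ c_1 v_j = v_j c_1,\quad j>2,\\ (v_1c_1 v_1)(v_2c_1 v_2)(v_1c_1 v_1) = (v_2c_1 v_2)(v_1c_1 v_1)(v_2c_1 v_2),\\ v_1(v_2c_1v_2v_1c_1) = (v_2c_1v_2v_1c_1)v_2,\\ c_1(v_2v_3v_1v_2c_1v_2v_1v_3v_2) = (v_2v_3v_1v_2c_1v_2v_1v_3v_2)c_1. \end{array}$$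
   Context: The flat unrestricted braid group $FU_n$ is the quotient of the flat virtual braid group $FV_n$ by the relations $c_ic_{i+1}v_i=v_{i+1}c_ic_{i+1}$. Here $FV_n$ is the group with generators $c_1,\ldots,c_{n-1}$ (flat generators) and $v_1,\ldots,v_{n-1}$ (virtual generators) and the following relations: flat relations $c_i^2=1$, $c_ic_{i+1}c_i=c_{i+1}c_ic_{i+1}$, and $c_ic_j=c_jc_i$ for $|i-j|\ge 2$; virtual relations $v_i^2=1$, $v_iv_{i+1}v_i=v_{i+1}v_iv_{i+1}$, and $v_iv_j=v_jv_i$ for $|i-j|\ge 2$; mixed flat relations $c_iv_j=v_jc_i$ for $|i-j|\ge 2$ and $v_ic_{i+1}v_i=v_{i+1}c_iv_{i+1}$. In $FU_n$ the other flat generators are expressed through the generators of the reduced presentation by $$c_{i+1} = (v_i\cdots v_2v_1)(v_{i+1}\cdots v_3v_2)\,c_1\,(v_2v_3\cdots v_{i+1})(v_1v_2\cdots v_i),\qquad 1\le i\le n-2.$$ In every presentation, a relation is included exactly when all indices occurring in it lie in $\{1,\ldots,n-1\}$. *)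

(* Defs.v *)
From HB Require Import structures.
From mathcomp Require Import all_boot.
From mathcomp Require Import boolp.

Set Implicit Arguments.
Unset Strict Implicit.
Unset Printing Implicit Defensive.

Local Open Scope group_scope.
Local Open Scope quotient_scope.

Section Congruence.
Variables (T : Type) (op : T -> T -> T) (R : T -> T -> Prop).

Inductive cong : T -> T -> Prop :=
| cong_base x y of R x y : cong x y
| cong_refl x : cong x x
| cong_sym x y of cong x y : cong y x
| cong_trans y x z of cong x y & cong y z : cong x z
| cong_op x x' y y' of cong x x' & cong y y' : cong (op x y) (op x' y').

Definition congb : rel T := fun x y => `[< cong x y >].

Lemma congb_refl : reflexive congb.
Proof. by move=> x; apply/asboolP/cong_refl. Qed.

Lemma congb_sym : symmetric congb.
Proof. by move=> x y; apply/asboolP/asboolP; apply: cong_sym. Qed.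

Lemma congb_trans : transitive congb.
Proof. by move=> y x z /asboolP h /asboolP h'; apply/asboolP/(cong_trans h h'). Qed.

Canonical cong_equiv := EquivRel congb congb_refl congb_sym congb_trans.
End Congruence.

Section FreeGroup.
Variable X : choiceType.

(* (x, false) stands for x and (x, true) for its inverse *)
Definition word := seq (X * bool).

Variant cancels : word -> word -> Prop :=
  Cancels x b : cancels [:: (x, b); (x, ~~ b)] [::].

Definition free_group : Type := {eq_quot (cong_equiv (@cat (X * bool)) cancels)}.
HB.instance Definition _ := Choice.on free_group.
HB.instance Definition _ := Quotient.on free_group.

Definition word_inv (w : word) : word := rev [seq (p.1, ~~ p.2) | p <- w].

Definition free_mul (a b : free_group) : free_group :=
  \pi_free_group (repr a ++ repr b).
Definition free_one : free_group := \pi_free_group [::].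
Definition free_inv (a : free_group) : free_group :=
  \pi_free_group (word_inv (repr a)).

Lemma free_eqP (u v : word) :
  \pi_free_group u = \pi_free_group v <-> cong cat cancels u v.
Proof. by split=> [/eqmodP/asboolP|h]; last by apply/eqmodP/asboolP. Qed.

Lemma free_repr (u : word) : cong cat cancels (repr (\pi_free_group u)) u.
Proof. by apply/free_eqP; rewrite reprK. Qed.

Lemma free_mulE (u v : word) :
  free_mul (\pi_free_group u) (\pi_free_group v) = \pi_free_group (u ++ v).
Proof. by apply/free_eqP; apply: cong_op; apply: free_repr. Qed.

Lemma word_mulVw (w : word) : cong cat cancels (word_inv w ++ w) [::].
Proof.
elim: w => [|[x b] w IH]; first exact: cong_refl.
rewrite /word_inv map_cons rev_cons -cats1 -catA /=.
apply: cong_trans IH; apply: cong_op; first exact: cong_refl.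
rewrite -cat1s -[_ :: w]cat1s catA -[w in cong _ _ _ w]cat0s.
apply: cong_op; last exact: cong_refl.
by apply: cong_base; have := Cancels x (~~ b); rewrite negbK.
Qed.

Lemma word_invK : involutive word_inv.
Proof.
move=> w; rewrite /word_inv map_rev revK -map_comp -[RHS]map_id.
by apply: eq_map => -[x b] /=; rewrite negbK.
Qed.

Lemma word_mulwV (w : word) : cong cat cancels (w ++ word_inv w) [::].
Proof. by rewrite -{1}(word_invK w); apply: word_mulVw. Qed.

Lemma free_mulA : associative free_mul.
Proof.
elim/quotW=> a; elim/quotW=> b; elim/quotW=> c.
by rewrite (free_mulE b c) (free_mulE a b) !free_mulE catA.
Qed.

Lemma free_mul1 : left_id free_one free_mul.
Proof. by move=> a; rewrite -(reprK a) free_mulE. Qed.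

Lemma free_mulr1 : right_id free_one free_mul.
Proof. by move=> a; rewrite -(reprK a) free_mulE cats0. Qed.

Lemma free_mulV : left_inverse free_one free_inv free_mul.
Proof.
move=> a; rewrite -{2}(reprK a) free_mulE.
by apply/free_eqP/word_mulVw.
Qed.

Lemma free_mulrV : right_inverse free_one free_inv free_mul.
Proof.
move=> a; rewrite -{1}(reprK a) free_mulE.
by apply/free_eqP/word_mulwV.
Qed.

HB.instance Definition _ := isGroup.Build free_group
  free_mulA free_mul1 free_mulr1 free_mulV free_mulrV.

Definition free_gen (x : X) : free_group := \pi_free_group [:: (x, false)].
End FreeGroup.

(* The quotient of G by the normal closure of the elements x / y with R x y,
   that is, by the smallest congruence containing R *)
Section QuotientByRelations.
Variables (G : groupType) (R : G -> G -> Prop).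

Definition quot_group : Type := {eq_quot (cong_equiv (@mul G) R)}.
HB.instance Definition _ := Choice.on quot_group.
HB.instance Definition _ := Quotient.on quot_group.

Definition quot_mul (a b : quot_group) : quot_group :=
  \pi_quot_group (repr a * repr b).
Definition quot_one : quot_group := \pi_quot_group 1.
Definition quot_inv (a : quot_group) : quot_group :=
  \pi_quot_group (repr a)^-1.

Lemma quot_eqP (x y : G) :
  \pi_quot_group x = \pi_quot_group y <-> cong *%g R x y.
Proof. by split=> [/eqmodP/asboolP|h]; last by apply/eqmodP/asboolP. Qed.

Lemma quot_repr (x : G) : cong *%g R (repr (\pi_quot_group x)) x.
Proof. by apply/quot_eqP; rewrite reprK. Qed.

Lemma quot_mulE (x y : G) :
  quot_mul (\pi_quot_group x) (\pi_quot_group y) = \pi_quot_group (x * y).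
Proof. by apply/quot_eqP; apply: cong_op; apply: quot_repr. Qed.

Lemma quot_mulA : associative quot_mul.
Proof.
elim/quotW=> a; elim/quotW=> b; elim/quotW=> c.
by rewrite (quot_mulE b c) (quot_mulE a b) !quot_mulE mulgA.
Qed.

Lemma quot_mul1 : left_id quot_one quot_mul.
Proof. by move=> a; rewrite -(reprK a) quot_mulE mul1g. Qed.

Lemma quot_mulr1 : right_id quot_one quot_mul.
Proof. by move=> a; rewrite -(reprK a) quot_mulE mulg1. Qed.

Lemma quot_mulV : left_inverse quot_one quot_inv quot_mul.
Proof. by move=> a; rewrite -{2}(reprK a) quot_mulE mulVg. Qed.

Lemma quot_mulrV : right_inverse quot_one quot_inv quot_mul.
Proof. by move=> a; rewrite -{1}(reprK a) quot_mulE mulgV. Qed.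

HB.instance Definition _ := isGroup.Build quot_group
  quot_mulA quot_mul1 quot_mulr1 quot_mulV quot_mulrV.

Definition quot_proj (x : G) : quot_group := \pi_quot_group x.
End QuotientByRelations.

(* A relation u = v between words in the generators X is a pair R u v *)
Definition presented (X : choiceType)
    (R : free_group X -> free_group X -> Prop) : groupType := quot_group R.

Definition presented_gen (X : choiceType)
    (R : free_group X -> free_group X -> Prop) (x : X) : presented R :=
  quot_proj R (free_gen x).

(* < X | R > is a presentation of G, the generator x being the element g x *)
Definition has_presentation (G : groupType) (X : choiceType) (g : X -> G)
    (R : free_group X -> free_group X -> Prop) : Prop :=
  exists f : {multiplicative presented R -> G},
    bijective f /\ forall x, f (presented_gen R x) = g x.

(* The indices 1, ..., n-1 *)
Record idx (n : nat) := Idx { idx_val :> nat; idxP : 0 < idx_val < n }.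
HB.instance Definition _ n := [isSub for @idx_val n].
HB.instance Definition _ n := [Choice of idx n by <:].

Definition idx1 (n : nat) (hn : 1 < n) : idx n := @Idx n 1 hn.

(* |i - j| >= 2 *)
Definition far (i j : nat) : bool := (i + 2 <= j) || (j + 2 <= i).

(* inl i is the flat generator c_i, inr i the virtual generator v_i *)
Definition FV_idx (n : nat) : choiceType := (idx n + idx n)%type.

Section FVRelations.
Variable n : nat.
Local Notation c i := (free_gen (inl i : FV_idx n)).
Local Notation v i := (free_gen (inr i : FV_idx n)).

Variant FV_rel : free_group (FV_idx n) -> free_group (FV_idx n) -> Prop :=
| FV_flat_sq (i : idx n) : FV_rel (c i ^+ 2) 1
| FV_flat_braid (i j : idx n) of j = i.+1 :> nat :
    FV_rel (c i * c j * c i) (c j * c i * c j)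
| FV_flat_comm (i j : idx n) of far i j : FV_rel (c i * c j) (c j * c i)
| FV_virt_sq (i : idx n) : FV_rel (v i ^+ 2) 1
| FV_virt_braid (i j : idx n) of j = i.+1 :> nat :
    FV_rel (v i * v j * v i) (v j * v i * v j)
| FV_virt_comm (i j : idx n) of far i j : FV_rel (v i * v j) (v j * v i)
| FV_mixed_comm (i j : idx n) of far i j : FV_rel (c i * v j) (v j * c i)
| FV_mixed (i j : idx n) of j = i.+1 :> nat :
    FV_rel (v i * c j * v i) (v j * c i * v j).
End FVRelations.

Definition FV (n : nat) : groupType := presented (@FV_rel n).
Definition FV_c n (i : idx n) : FV n := presented_gen (@FV_rel n) (inl i).
Definition FV_v n (i : idx n) : FV n := presented_gen (@FV_rel n) (inr i).

Variant FU_rel (n : nat) : FV n -> FV n -> Prop :=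
  FU_forbidden (i j : idx n) of j = i.+1 :> nat :
    FU_rel (FV_c i * FV_c j * FV_v i) (FV_v j * FV_c i * FV_c j).

Definition FU (n : nat) : groupType := quot_group (@FU_rel n).
Definition FU_c n (i : idx n) : FU n := quot_proj (@FU_rel n) (FV_c i).
Definition FU_v n (i : idx n) : FU n := quot_proj (@FU_rel n) (FV_v i).

(* None is the generator c_1, Some i the generator v_i *)
Definition red_idx (n : nat) : choiceType := option (idx n).

Definition red_gen (n : nat) (hn : 1 < n) (x : red_idx n) : FU n :=
  if x is Some i then FU_v i else FU_c (idx1 hn).

(* In the last three relations i1, i2, i3 are the indices 1, 2, 3, so that a
   relation is present only when n is large enough for its indices to exist *)
Section ReducedRelations.
Variable n : nat.
Local Notation c1 := (free_gen (None : red_idx n)).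
Local Notation v i := (free_gen (Some i : red_idx n)).

Variant red_rel : free_group (red_idx n) -> free_group (red_idx n) -> Prop :=
| red_virt_braid (i j : idx n) of j = i.+1 :> nat :
    red_rel (v i * v j * v i) (v j * v i * v j)
| red_virt_comm (i j : idx n) of j <> i.+1 :> nat & i <> j.+1 :> nat :
    red_rel (v i * v j) (v j * v i)
| red_flat_sq : red_rel (c1 ^+ 2) 1
| red_virt_sq (i : idx n) : red_rel (v i ^+ 2) 1
| red_mixed_comm (j : idx n) of 2 < j : red_rel (c1 * v j) (v j * c1)
| red_flat_braid (i1 i2 : idx n) of i1 = 1%N :> nat & i2 = 2 :> nat :
    red_rel
      ((v i1 * c1 * v i1) * (v i2 * c1 * v i2) * (v i1 * c1 * v i1))
      ((v i2 * c1 * v i2) * (v i1 * c1 * v i1) * (v i2 * c1 * v i2))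
| red_forbidden (i1 i2 : idx n) of i1 = 1%N :> nat & i2 = 2 :> nat :
    red_rel (v i1 * (v i2 * c1 * v i2 * v i1 * c1))
            ((v i2 * c1 * v i2 * v i1 * c1) * v i2)
| red_flat_comm (i1 i2 i3 : idx n)
    of i1 = 1%N :> nat & i2 = 2 :> nat & i3 = 3 :> nat :
    red_rel
      (c1 * (v i2 * v i3 * v i1 * v i2 * c1 * v i2 * v i1 * v i3 * v i2))
      ((v i2 * v i3 * v i1 * v i2 * c1 * v i2 * v i1 * v i3 * v i2) * c1).
End ReducedRelations.

(* Main.v *)
From HB Require Import structures.
Require Import Defs.
From mathcomp Require Import all_boot zify.

(** The mixed relation v_i c_(i+1) v_i = v_(i+1) c_i v_(i+1) says exactly that
    c_(i+1) is the conjugate of c_i by v_(i+1) v_i ([mixed_conjE]), so FU_n is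
    generated by c_1 and the v_i, and every relation of FU_n can be rewritten
    in them.  The relations of lowest index become, up to conjugation and
    inversion, the relations of the reduced presentation
    ([flat_braid_reducedE], [forbidden_reducedE], [flat2E]).

    The content of the theorem is that the relations of higher index follow,
    when c_(i+1) is defined by that conjugation.  The symmetric group
    generated by the v_i acts by conjugation, and it moves a relation along the
    strands.  First, v_j commutes with c_i as soon as |i - j| >= 2: for j above
    i this comes from c_1 v_j = v_j c_1, and for j below i the conjugation that
    turns c_(i-2) into c_i turns v_i into v_(i-2) ([flat_virt_comm_above],
    [flat_virt_comm_below]).  Then conjugation by the cycle
    v_(i+2) v_(i+1) v_i sends c_i, c_(i+1), v_i, v_(i+1) to the generators of
    the next index ([shift_conj]), which carries the braid and the forbidden
    relations from i to i + 1; and conjugation by v_(j+1) v_j v_(i+1) v_i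
    carries the commutation of c_i and c_j to that of c_(i+1) and c_(j+1).
    Hence [FU_relations_of_reduced], with the converse
    [reduced_relations_of_FU].

    Both groups then map to each other by their universal properties
    ([FU_lift], [red_lift]), and the two composites fix the generators. *)

Set Implicit Arguments.
Unset Strict Implicit.
Unset Printing Implicit Defensive.

Local Open Scope group_scope.
Local Open Scope quotient_scope.

(** * Conjugation by involutions *)

Section GroupIdentities.
Variable G : groupType.
Implicit Types a x y z : G.

Lemma commute_conj x y : commute x y -> x ^ y = x.
Proof. by move=> xy; rewrite conjgE xy mulKg. Qed.

Lemma commuteJ x y z : commute x y -> commute (x ^ z) (y ^ z).
Proof. by rewrite /commute -!conjMg => ->. Qed.

Lemma commuteJ_fix x y z : commute x z -> commute y z -> commute (x ^ y) z.
Proof.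
by move=> xz yz; rewrite -(commute_conj (commute_sym yz)); apply: commuteJ.
Qed.

(** For adjacent transpositions x and y, the 3-cycle y x moves the support of x
    to that of y. *)
Lemma braid_conj x y : x * y * x = y * x * y -> x ^ (y * x) = y.
Proof. by move=> xyx; rewrite conjgE (mulgA x) xyx mulKg. Qed.

Section Involutions.
Variables a x y : G.
Hypotheses (xx : x * x = 1) (yy : y * y = 1).

(** Taken at x = v_i, y = v_(i+1) and a = c_i, this solves the mixed relation
    for c = c_(i+1). *)
Lemma mixed_conjE c : x * c * x = y * a * y <-> c = a ^ (y * x).
Proof.
rewrite conjgE invgM (mulg1_eq xx) (mulg1_eq yy); split=> [xcx|->].
  have -> : x * y * (a * (y * x)) = x * (y * a * y) * x by rewrite !mulgA.
  by rewrite -xcx !mulgA xx mul1g -mulgA xx mulg1.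
by rewrite !mulgA xx mul1g -!mulgA xx mulg1.
Qed.

(** With x = v_1, y = v_2 and a = c_1, conjugation by x turns a and c into x a x
    and y a y, so that it exchanges the braid relation of a and c with the
    reduced one. *)
Lemma flat_braid_reducedE (c := a ^ (y * x)) :
  a * c * a = c * a * c <->
  (x * a * x) * (y * a * y) * (x * a * x) =
  (y * a * y) * (x * a * x) * (y * a * y).
Proof.
have conjE z : z * z = 1 -> z * a * z = a ^ z.
  by move=> zz; rewrite conjgE (mulg1_eq zz) mulgA.
have ay : a ^ y = c ^ x by rewrite -conjgM -mulgA xx mulg1.
rewrite (conjE x) // (conjE y) // ay -!conjMg.
by split=> [->|/conjg_inj].
Qed.

(** The sides of the reduced relation are the inverses of a c and y a c x. *)
Lemma forbidden_reducedE (c := a ^ (y * x)) : a * a = 1 ->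
  a * c * x = y * a * c <->
  x * (y * a * y * x * a) = (y * a * y * x * a) * y.
Proof.
move=> aa; have cE: c = x * y * a * y * x.
  by rewrite /c conjgE invgM (mulg1_eq xx) (mulg1_eq yy) !mulgA.
have [xV yV aV] := And3 (mulg1_eq xx) (mulg1_eq yy) (mulg1_eq aa).
have LE: x * (y * a * y * x * a) = (a * c)^-1.
  by rewrite cE !invgM xV yV aV !mulgA.
have RE: (y * a * y * x * a) * y = (y * a * c * x)^-1.
  by rewrite cE !invgM xV yV aV !mulgA xx mul1g.
rewrite LE RE; split=> [<-|/invg_inj ->]; last by rewrite -!mulgA xx mulg1.
by rewrite -!mulgA xx mulg1.
Qed.
End Involutions.
End GroupIdentities.

(** * The two systems of relations *)

(** Generators are counted from 0 here: [v k] is v_(k+1), [c k] is c_(k+1) and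
    [m] is n-1, so that recursion on the index starts at c_1. *)
Record virtual_relations (G : groupType) (m : nat) (v : nat -> G) : Prop := {
  virt_sq k : k < m -> v k * v k = 1;
  virt_braid k : k.+1 < m -> v k * v k.+1 * v k = v k.+1 * v k * v k.+1;
  virt_comm k l : k.+1 < l -> l < m -> commute (v k) (v l)
}.

Record FU_relations (G : groupType) (m : nat) (c v : nat -> G) : Prop := {
  FU_virtual : virtual_relations m v;
  flat_sq k : k < m -> c k * c k = 1;
  flat_braid k : k.+1 < m -> c k * c k.+1 * c k = c k.+1 * c k * c k.+1;
  flat_comm k l : k.+1 < l -> l < m -> commute (c k) (c l);
  mixed_comm k l : far k l -> k < m -> l < m -> commute (c k) (v l);
  mixed k : k.+1 < m -> v k * c k.+1 * v k = v k.+1 * c k * v k.+1;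
  forbidden k : k.+1 < m -> c k * c k.+1 * v k = v k.+1 * c k * c k.+1
}.

Record reduced_relations (G : groupType) (m : nat) (a : G) (v : nat -> G) :
  Prop := {
  reduced_virtual : virtual_relations m v;
  reduced_sq : a * a = 1;
  reduced_mixed_comm l : 1 < l -> l < m -> commute a (v l);
  reduced_braid : 1 < m ->
    (v 0 * a * v 0) * (v 1%N * a * v 1%N) * (v 0 * a * v 0) =
    (v 1%N * a * v 1%N) * (v 0 * a * v 0) * (v 1%N * a * v 1%N);
  reduced_forbidden : 1 < m ->
    v 0 * (v 1%N * a * v 1%N * v 0 * a) = (v 1%N * a * v 1%N * v 0 * a) * v 1%N;
  reduced_comm : 2 < m ->
    commute a (v 1%N * v 2 * v 0 * v 1%N * a * v 1%N * v 0 * v 2 * v 1%N)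
}.

(** The word expressing c_(k+1) by a = c_1 and the virtual generators. *)
Fixpoint flat (G : groupType) (a : G) (v : nat -> G) (k : nat) : G :=
  if k is k'.+1 then flat a v k' ^ (v k'.+1 * v k') else a.

(** * From the lowest indices to all indices *)

Section Virtual.
Variables (G : groupType) (m : nat) (v : nat -> G).
Hypothesis virt : virtual_relations m v.

Lemma conj_virt_up k : k.+1 < m -> v k ^ (v k.+1 * v k) = v k.+1.
Proof. by move=> km; apply/braid_conj/(virt_braid virt). Qed.

Lemma conj_virt_down k : k.+1 < m -> v k.+1 ^ (v k * v k.+1) = v k.
Proof. by move=> km; apply/braid_conj/esym/(virt_braid virt). Qed.

Lemma flat2E a : 2 < m ->
  flat a v 2 = v 1%N * v 2 * v 0 * v 1%N * a * v 1%N * v 0 * v 2 * v 1%N.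
Proof.
move=> m2; have vV k : k <= 2 -> (v k)^-1 = v k.
  by move=> k2; apply/mulg1_eq/(virt_sq virt)/(leq_ltn_trans k2).
by rewrite /= !conjgE !invgM !vV // !mulgA.
Qed.
End Virtual.

Section Shift.
Variables (G : groupType) (m : nat) (a : G) (v : nat -> G).
Hypothesis red : reduced_relations m a v.
Let virt := reduced_virtual red.
Local Notation f := (flat a v).

Lemma flat_virt_comm_above k l : k.+1 < l -> l < m -> commute (f k) (v l).
Proof.
elim: k => [|k IHk] kl lm; first exact: (reduced_mixed_comm red).
apply: commuteJ_fix; first by apply: IHk => //; lia.
by apply/commute_sym/commuteM; apply/commute_sym/(virt_comm virt); lia.
Qed.

(** The last conjugation defining [f k] commutes with v_l unless k = l + 2.  In
    that case a product w of four virtual generators conjugates [f l] to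
    [f l.+2] and v_(l+2) to v_l, so it carries over the commutation of [f l] and
    v_(l+2), where the virtual index is the larger one. *)
Lemma flat_virt_comm_below k l : k < m -> l.+1 < k -> commute (f k) (v l).
Proof.
elim: k => // k IHk km; rewrite ltnS leq_eqVlt => /predU1P[lk|lk]; last first.
  apply: commuteJ_fix; first by apply: IHk => //; lia.
  by apply/commute_sym/commuteM; apply: (virt_comm virt); lia.
rewrite -{}lk in km *; set w := v l.+1 * v l * v l.+2 * v l.+1.
have -> : f l.+2 = f l ^ w by rewrite /= -!conjgM /w !mulgA.
have <- : v l.+2 ^ w = v l.
  rewrite /w -(mulgA (v l.+1)) (virt_comm virt (ltnSn l.+1) km) !mulgA.
  rewrite -(mulgA (v l.+1 * v l.+2)) conjgM (conj_virt_down virt) //.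
  by apply: (conj_virt_down virt); lia.
by apply/commuteJ/flat_virt_comm_above.
Qed.

(** The witness v_(k+2) v_(k+1) v_k is the 4-cycle on consecutive strands that
    moves the first three of them one step on.  In each equation two adjacent
    factors do the move, and the third one commutes with what it meets. *)
Lemma shift_conj k : k.+2 < m ->
  exists s, [/\ v k ^ s = v k.+1, v k.+1 ^ s = v k.+2,
                f k ^ s = f k.+1 & f k.+1 ^ s = f k.+2].
Proof.
move=> km; exists (v k.+2 * v k.+1 * v k); split.
- rewrite -mulgA conjgM (commute_conj (virt_comm virt (ltnSn k.+1) km)).
  by apply: (conj_virt_up virt); lia.
- rewrite conjgM (conj_virt_up virt) //.
  by apply/commute_conj/commute_sym/(virt_comm virt).
- rewrite -mulgA conjgM (@commute_conj _ (f k)) //.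
  exact: flat_virt_comm_above.
- by rewrite conjgM; apply/commute_conj/(@flat_virt_comm_below k.+2).
Qed.

Lemma flat_braid_reduced k :
  k.+1 < m -> f k * f k.+1 * f k = f k.+1 * f k * f k.+1.
Proof.
elim: k => [|k IHk] km.
  apply/(flat_braid_reducedE a (virt_sq virt (ltnW km)) (virt_sq virt km)).
  exact: (reduced_braid red).
have [s [_ _ fS fSS]] := shift_conj km.
by rewrite -fSS -{1 3 5}fS -!conjMg IHk // ltnW.
Qed.

Lemma forbidden_reduced k :
  k.+1 < m -> f k * f k.+1 * v k = v k.+1 * f k * f k.+1.
Proof.
elim: k => [|k IHk] km.
  apply/(forbidden_reducedE (virt_sq virt (ltnW km)) (virt_sq virt km)
    (reduced_sq red)).
  exact: (reduced_forbidden red).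
have [s [vS vSS fS fSS]] := shift_conj km.
by rewrite -fSS -{1 3}fS -vSS -{1}vS -!conjMg IHk // ltnW.
Qed.

(** The first row, where k = 0, is obtained from c_1 c_3 = c_3 c_1 by moving the
    second index up; the pairs (k+1, l+1) then come from (k, l). *)
Lemma flat_comm_reduced k l : k.+1 < l -> l < m -> commute (f k) (f l).
Proof.
elim: k l => [|k IHk] [|l] // kl lm.
  elim: l kl lm => // -[|l] IHl _ lm.
    by rewrite (flat2E virt) //; apply: (reduced_comm red).
  apply/commute_sym/commuteJ_fix; first by apply/commute_sym/IHl => //; lia.
  by apply/commute_sym/commuteM; apply: (reduced_mixed_comm red); lia.
(* the pair of l acts first: it fixes c_k, while v_l need not fix c_(k+1);
   after it, the pair of k only meets c_(l+1), far above *)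
set w := v l.+1 * v l * (v k.+1 * v k).
have <- : f k ^ w = f k.+1.
  rewrite /w conjgM (@commute_conj _ (f k)) //.
  by apply: commuteM; apply: flat_virt_comm_above; lia.
have <- : f l ^ w = f l.+1.
  rewrite /w conjgM -/(f l.+1) commute_conj //.
  by apply: commuteM; apply: flat_virt_comm_below; lia.
by apply/commuteJ/IHk; lia.
Qed.

Lemma FU_relations_of_reduced : FU_relations m f v.
Proof.
split=> //.
- elim=> [|k IHk] km; first exact: (reduced_sq red).
  by rewrite -conjMg IHk ?conj1g //; lia.
- exact: flat_braid_reduced.
- exact: flat_comm_reduced.
- move=> k l /orP[] kl km lm.
    by apply: flat_virt_comm_above => //; lia.
  by apply: flat_virt_comm_below => //; lia.
- move=> k km.
  by apply/(mixed_conjE _ (virt_sq virt (ltnW km)) (virt_sq virt km) _).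
- exact: forbidden_reduced.
Qed.
End Shift.

Section Reduction.
Variables (G : groupType) (m : nat) (c v : nat -> G).
Hypothesis fu : FU_relations m c v.
Let virt := FU_virtual fu.

Lemma flatE k : k < m -> c k = flat (c 0) v k.
Proof.
elim: k => // k IHk km; rewrite /= -IHk ?(ltnW km) //.
apply/(mixed_conjE _ (virt_sq virt (ltnW km)) (virt_sq virt km) _).
exact: (mixed fu).
Qed.

Lemma reduced_relations_of_FU : 0 < m -> reduced_relations m (c 0) v.
Proof.
move=> m0; split=> //.
- exact: (flat_sq fu).
- by move=> l l1 lm; apply: (mixed_comm fu) => //; apply/orP; left; lia.
- move=> m1.
  apply/(flat_braid_reducedE _ (virt_sq virt m0) (virt_sq virt m1)).
  by rewrite -[_ ^ _]/(flat (c 0) v 1%N) -flatE //; apply: (flat_braid fu).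
- move=> m1.
  apply/(forbidden_reducedE (virt_sq virt m0) (virt_sq virt m1)
    (flat_sq fu m0)).
  by rewrite -[_ ^ _]/(flat (c 0) v 1%N) -flatE //; apply: (forbidden fu).
- by move=> m2; rewrite -(flat2E virt) // -flatE //; apply: (flat_comm fu).
Qed.
End Reduction.

(** * Morphisms out of a presented group *)

Section MultiplicativeFunctions.
Variables (G H : groupType) (f : {multiplicative G -> H}).

Lemma multiplicative1 : f 1 = 1.
Proof. by apply: (mulgI (f 1)); rewrite -gmulfM !mulg1. Qed.

Lemma multiplicativeV x : f x^-1 = (f x)^-1.
Proof. by apply/esym/mulg1_eq; rewrite -gmulfM mulgV multiplicative1. Qed.

Lemma multiplicativeJ x y : f (x ^ y) = f x ^ f y.
Proof. by rewrite !gmulfM multiplicativeV. Qed.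

End MultiplicativeFunctions.

Lemma free_ind (X : choiceType) (P : free_group X -> Prop) :
  P 1 -> (forall x a, P a -> P (free_gen x * a)) ->
  (forall x a, P a -> P ((free_gen x)^-1 * a)) -> forall a, P a.
Proof.
move=> P1 Pgen PgenV; elim/quotW; elim=> [|[x b] w IHw] //.
have -> : \pi_(free_group X) ((x, b) :: w) =
    \pi_(free_group X) [:: (x, b)] * \pi_(free_group X) w.
  by rewrite /= [RHS]free_mulE.
case: b; last exact: Pgen.
have -> : \pi_(free_group X) [:: (x, true)] = (free_gen x)^-1.
  apply/esym/mulg1_eq; rewrite [LHS]free_mulE.
  exact/free_eqP/cong_base/(Cancels x false).
exact: PgenV.
Qed.

Lemma free_lift (X : choiceType) (G : groupType) (h : X -> G) :
  exists f : {multiplicative free_group X -> G},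
    forall x, f (free_gen x) = h x.
Proof.
pose ev (w : word X) := \prod_(p <- w) (if p.2 then (h p.1)^-1 else h p.1).
have ev_cong u w : cong cat (@cancels X) u w -> ev u = ev w.
  elim=> {u w} [_ _ [x b]|//|//|u w z _ -> _ -> //|].
    rewrite /ev !big_cons !big_nil mulg1.
    by case: b => /=; rewrite ?mulVg ?mulgV.
  move=> u u' w w' _ IHu _ IHw.
  by rewrite /ev !big_cat -/(ev u) IHu -/(ev w) IHw.
pose f (a : free_group X) := ev (repr a).
have fpi u : f (\pi u) = ev u by apply/ev_cong/free_repr.
have fM : {morph f : a b / a * b}.
  elim/quotW=> u; elim/quotW=> w.
  by rewrite [X in f X]free_mulE !fpi /ev big_cat.
pose fm : {multiplicative free_group X -> G} :=
  HB.pack f (isMultiplicative.Build _ _ f fM).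
by exists fm => x; rewrite /= fpi /ev big_seq1.
Qed.

Section QuotientMaps.
Variables (G : groupType) (R : G -> G -> Prop).

Lemma quot_projM : {morph quot_proj R : x y / x * y}.
Proof. by move=> x y; rewrite [RHS]quot_mulE. Qed.

HB.instance Definition _ := isMultiplicative.Build _ _ (quot_proj R) quot_projM.

Lemma quot_proj_rel x y : R x y -> quot_proj R x = quot_proj R y.
Proof. by move=> Rxy; apply/quot_eqP/cong_base. Qed.

Lemma quot_lift (H : groupType) (f : {multiplicative G -> H}) :
  (forall x y, R x y -> f x = f y) ->
  exists g : {multiplicative quot_group R -> H},
    forall x, g (quot_proj R x) = f x.
Proof.
move=> fR; have f_cong x y : cong *%g R x y -> f x = f y.
  elim=> {x y} [x y /fR //|//|//|y x z _ -> _ -> //|].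
  by move=> x x' y y' _ fx _ fy; rewrite !gmulfM fx fy.
pose g (a : quot_group R) := f (repr a).
have gpi x : g (quot_proj R x) = f x by apply/f_cong/quot_repr.
have gM : {morph g : a b / a * b}.
  elim/quotW=> x; elim/quotW=> y.
  by rewrite -[X in g X]quot_projM !gpi gmulfM.
pose gm : {multiplicative quot_group R -> H} :=
  HB.pack g (isMultiplicative.Build _ _ g gM).
by exists gm.
Qed.
End QuotientMaps.

Section PresentedGroups.
Variables (X : choiceType) (R : free_group X -> free_group X -> Prop).

(** The hypothesis asks for the relations in terms of an arbitrary evaluation
    morphism f, so that they can be checked by pushing f through the words
    without ever computing an evaluation. *)
Lemma presented_lift (G : groupType) (h : X -> G) :
  (forall f : {multiplicative free_group X -> G},
     (forall x, f (free_gen x) = h x) -> forall u w, R u w -> f u = f w) ->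
  exists f : {multiplicative presented R -> G},
    forall x, f (presented_gen R x) = h x.
Proof.
move=> hR; have [f0 f0E] := free_lift h.
have [f fE] := quot_lift (hR f0 f0E).
by exists f => x; rewrite fE.
Qed.

Lemma presented_eq (G : groupType) (f g : {multiplicative presented R -> G}) :
  (forall x, f (presented_gen R x) = g (presented_gen R x)) -> f =1 g.
Proof.
move=> fg; elim/quotW => a; rewrite -/(quot_proj R a).
elim/free_ind: a => [|x a IHa|x a IHa]; first by rewrite !multiplicative1.
  by rewrite !gmulfM IHa fg.
by rewrite !gmulfM IHa !multiplicativeV fg.
Qed.
End PresentedGroups.

Lemma eq_FU_morphism n (G : groupType) (f g : {multiplicative FU n -> G}) :
  (forall i, f (FU_c i) = g (FU_c i)) ->
  (forall i, f (FU_v i) = g (FU_v i)) -> f =1 g.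
Proof.
move=> fgc fgv; elim/quotW=> x.
have := @presented_eq _ _ _ (f \o quot_proj (@FU_rel n))
  (g \o quot_proj (@FU_rel n)).
by apply=> -[i|i]; [apply: fgc | apply: fgv].
Qed.

(** * Families indexed by 1, ..., n-1 as families indexed by nat *)

(** The default value 1 is only reached when k >= n.-1. *)
Definition pad n (G : groupType) (v : idx n -> G) (k : nat) : G :=
  if insub k.+1 is Some i then v i else 1.

Lemma padE n (G : groupType) (v : idx n -> G) (i : idx n) : pad v i.-1 = v i.
Proof.
by rewrite /pad prednK ?valK //; case/andP: (idxP i).
Qed.

Lemma pad_surj n k : k < n.-1 -> exists i : idx n, i = k.+1 :> nat.
Proof.
move=> kn; have kP : 0 < k.+1 < n by rewrite -ltn_predRL.
by exists (Idx kP).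
Qed.

Lemma padP n (G : groupType) (v : idx n -> G) (k : nat) (i : idx n) :
  i = k.+1 :> nat -> pad v k = v i.
Proof. by move=> ik; rewrite -padE ik. Qed.

Lemma idx_predK n (i : idx n) : i.-1.+1 = i.
Proof. by case: i => -[]. Qed.

Lemma idx_pred_lt n (i : idx n) : i.-1 < n.-1.
Proof. by rewrite ltn_predRL idx_predK; case/andP: (idxP i). Qed.

Lemma idx_pred_far n (i j : idx n) : i + 2 <= j -> i.-1.+1 < j.-1.
Proof. by rewrite addn2 => ij; rewrite -ltnS !idx_predK. Qed.

Lemma idx_pred_succ n (i j : idx n) :
  j = i.+1 :> nat -> i.-1.+1 < n.-1 /\ j.-1 = i.-1.+1.
Proof. by move=> ij; have := idx_pred_lt j; rewrite ij /= idx_predK. Qed.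

(** * The generators satisfy the relations, universally *)

Lemma FU_gen_relations n : FU_relations n.-1 (pad (@FU_c n)) (pad (@FU_v n)).
Proof.
have FVrel u w : FV_rel u w ->
    quot_proj (@FU_rel n) (quot_proj (@FV_rel n) u) =
    quot_proj (@FU_rel n) (quot_proj (@FV_rel n) w).
  by move=> /quot_proj_rel uw; apply: congr1 uw.
split; first split.
- move=> k km; have [i ik] := pad_surj km; rewrite !(padP _ ik).
  by have := FVrel _ _ (FV_virt_sq i); rewrite !gmulfM !multiplicative1.
- move=> k km; have [[i ik] [j jk]] := (pad_surj (ltnW km), pad_surj km).
  rewrite !(padP _ ik) !(padP _ jk) -!gmulfM.
  by apply/FVrel/FV_virt_braid; rewrite jk ik.
- move=> k l kl lm.
  have [[i ik] [j jl]] := (pad_surj (ltn_trans (ltnW kl) lm), pad_surj lm).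
  rewrite /commute !(padP _ ik) !(padP _ jl) -!gmulfM.
  by apply/FVrel/FV_virt_comm; rewrite /far ik jl; lia.
- move=> k km; have [i ik] := pad_surj km; rewrite !(padP _ ik).
  by have := FVrel _ _ (FV_flat_sq i); rewrite !gmulfM !multiplicative1.
- move=> k km; have [[i ik] [j jk]] := (pad_surj (ltnW km), pad_surj km).
  rewrite !(padP _ ik) !(padP _ jk) -!gmulfM.
  by apply/FVrel/FV_flat_braid; rewrite jk ik.
- move=> k l kl lm.
  have [[i ik] [j jl]] := (pad_surj (ltn_trans (ltnW kl) lm), pad_surj lm).
  rewrite /commute !(padP _ ik) !(padP _ jl) -!gmulfM.
  by apply/FVrel/FV_flat_comm; rewrite /far ik jl; lia.
- move=> k l kl km lm; have [[i ik] [j jl]] := (pad_surj km, pad_surj lm).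
  rewrite /commute !(padP _ ik) !(padP _ jl) -!gmulfM.
  by apply/FVrel/FV_mixed_comm; rewrite /far ik jl !addSn !ltnS.
- move=> k km; have [[i ik] [j jk]] := (pad_surj (ltnW km), pad_surj km).
  rewrite !(padP _ ik) !(padP _ jk) -!gmulfM.
  by apply/FVrel/FV_mixed; rewrite jk ik.
- move=> k km; have [[i ik] [j jk]] := (pad_surj (ltnW km), pad_surj km).
  have ij : j = i.+1 :> nat by rewrite jk ik.
  rewrite !(padP _ ik) !(padP _ jk).
  by have := quot_proj_rel (FU_forbidden ij); rewrite !gmulfM.
Qed.

Lemma FU_lift n (G : groupType) (c v : nat -> G) :
  FU_relations n.-1 c v ->
  exists f : {multiplicative FU n -> G},
    (forall i, f (FU_c i) = c i.-1) /\ (forall i, f (FU_v i) = v i.-1).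
Proof.
move=> fu; have virt := FU_virtual fu.
pose h (x : FV_idx n) := match x with inl i => c i.-1 | inr i => v i.-1 end.
have [f0 f0E u w uw|f fE] := @presented_lift _ (@FV_rel n) _ h.
  case: uw => [i|i j /idx_pred_succ[jn jE]|i j ij|i|i j /idx_pred_succ[jn jE]
              |i j ij|i j ij|i j /idx_pred_succ[jn jE]];
    rewrite !gmulfM ?multiplicative1 !f0E /= ?jE.
  - exact: (flat_sq fu (idx_pred_lt i)).
  - exact: (flat_braid fu).
  - case/orP: ij => ij; [|symmetry].
      by apply: (flat_comm fu); rewrite ?idx_pred_far ?idx_pred_lt.
    by apply: (flat_comm fu); rewrite ?idx_pred_far ?idx_pred_lt.
  - exact: (virt_sq virt (idx_pred_lt i)).
  - exact: (virt_braid virt).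
  - case/orP: ij => ij; [|symmetry].
      by apply: (virt_comm virt); rewrite ?idx_pred_far ?idx_pred_lt.
    by apply: (virt_comm virt); rewrite ?idx_pred_far ?idx_pred_lt.
  - apply: (mixed_comm fu); rewrite ?idx_pred_lt //.
    by move: ij; rewrite /far -(idx_predK i) -(idx_predK j) !addSn !ltnS.
  - exact: (mixed fu).
have [|g gE] := @quot_lift _ (@FU_rel n) _ f.
  move=> _ _ [i j /idx_pred_succ[jn jE]]; rewrite !gmulfM !fE /= jE.
  exact: (forbidden fu).
by exists g; split=> i; rewrite gE fE.
Qed.

Lemma red_gen_relations n :
  reduced_relations n.-1 (presented_gen (@red_rel n) None)
    (pad (fun i => presented_gen (@red_rel n) (Some i))).
Proof.
split; first split.
- move=> k km; have [i ik] := pad_surj km; rewrite !(padP _ ik).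
  by have := quot_proj_rel (red_virt_sq i); rewrite !gmulfM !multiplicative1.
- move=> k km; have [[i ik] [j jk]] := (pad_surj (ltnW km), pad_surj km).
  have ij : j = i.+1 :> nat by rewrite jk ik.
  rewrite !(padP _ ik) !(padP _ jk).
  by have := quot_proj_rel (red_virt_braid ij); rewrite !gmulfM.
- move=> k l kl lm.
  have [[i ik] [j jl]] := (pad_surj (ltn_trans (ltnW kl) lm), pad_surj lm).
  have [ij ji] : j <> i.+1 :> nat /\ i <> j.+1 :> nat by rewrite ik jl; lia.
  rewrite /commute !(padP _ ik) !(padP _ jl).
  by have := quot_proj_rel (red_virt_comm ij ji); rewrite !gmulfM.
- by have := quot_proj_rel (red_flat_sq n); rewrite !gmulfM !multiplicative1.
- move=> l l1 lm; have [j jl] := pad_surj lm.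
  have j2 : 2 < j by rewrite jl.
  rewrite /commute !(padP _ jl).
  by have := quot_proj_rel (red_mixed_comm j2); rewrite !gmulfM.
- move=> m1; have [[i i1] [j j2]] := (pad_surj (ltnW m1), pad_surj m1).
  rewrite !(padP _ i1) !(padP _ j2).
  by have := quot_proj_rel (red_flat_braid i1 j2); rewrite !gmulfM.
- move=> m1; have [[i i1] [j j2]] := (pad_surj (ltnW m1), pad_surj m1).
  rewrite !(padP _ i1) !(padP _ j2).
  by have := quot_proj_rel (red_forbidden i1 j2); rewrite !gmulfM.
- move=> m2; have [[i i1] [j j2] [k k3]] :=
    And3 (pad_surj (ltnW (ltnW m2))) (pad_surj (ltnW m2)) (pad_surj m2).
  rewrite /commute !(padP _ i1) !(padP _ j2) !(padP _ k3).
  by have := quot_proj_rel (red_flat_comm i1 j2 k3); rewrite !gmulfM.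
Qed.

Lemma red_lift n (G : groupType) (a : G) (v : nat -> G) :
  reduced_relations n.-1 a v ->
  exists f : {multiplicative presented (@red_rel n) -> G},
    f (presented_gen (@red_rel n) None) = a /\
    (forall i, f (presented_gen (@red_rel n) (Some i)) = v i.-1).
Proof.
move=> red; have virt := reduced_virtual red.
pose h (x : red_idx n) := if x is Some i then v i.-1 else a.
have [f0 f0E u w uw|f fE] := @presented_lift _ (@red_rel n) _ h; last first.
  by exists f; split=> [|i]; rewrite fE.
case: uw => [i j /idx_pred_succ[jn jE]|i j /eqP ij /eqP ji||i|j j2
            |i j i1 j2|i j i1 j2|i j k i1 j2 k3];
  rewrite !gmulfM ?multiplicative1 !f0E /= ?jE.
- exact: (virt_braid virt).
- have [ij' | ij' | ->//] := ltngtP i j; [|symmetry];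
    by apply: (virt_comm virt); rewrite ?idx_pred_far ?idx_pred_lt //; lia.
- exact: (reduced_sq red).
- exact: (virt_sq virt (idx_pred_lt i)).
- by apply: (reduced_mixed_comm red); rewrite ?idx_pred_lt // -ltnS idx_predK.
- by rewrite i1 j2; apply: (reduced_braid red);
     have := idx_pred_lt j; rewrite j2.
- by rewrite i1 j2; apply: (reduced_forbidden red);
     have := idx_pred_lt j; rewrite j2.
- by rewrite i1 j2 k3; apply: (reduced_comm red);
     have := idx_pred_lt k; rewrite k3.
Qed.

(** * The two presentations *)

Lemma multiplicative_flat (G H : groupType) (f : {multiplicative G -> H})
    a v w k :
  (forall l, l <= k -> f (v l) = w l) -> f (flat a v k) = flat (f a) w k.
Proof.
elim: k => //= k IHk fv; rewrite multiplicativeJ gmulfM !fv ?IHk //.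
by move=> l lk; apply/fv/leqW.
Qed.

Theorem theorem7 (n : nat) (hn : 1 < n) :
  has_presentation (red_gen hn) (@red_rel n).
Proof.
have n1 : 0 < n.-1 by lia.
have fu := FU_gen_relations n; have red := red_gen_relations n.
have [f [fa fv]] := red_lift (reduced_relations_of_FU fu n1).
have [g [gc gv]] := FU_lift (FU_relations_of_reduced red).
have fgen x : f (presented_gen (@red_rel n) x) = red_gen hn x.
  case: x => [i|]; first by rewrite fv padE.
  by rewrite fa (padP _ (_ : idx1 hn = 1%N :> nat)).
exists f; split=> //; exists g.
  apply: (presented_eq (f := g \o f) (g := idfun)) => -[i|] /=.
    by rewrite fv padE gv padE.
  by rewrite fa (padP _ (_ : idx1 hn = 1%N :> nat)) // gc.
apply: (eq_FU_morphism (f := f \o g) (g := idfun)) => i /=; last first.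
  by rewrite gv padE fv padE.
have im : i.-1 < n.-1 by case: i => [[|k] /=]; lia.
(* f sends the word that defines c_i in the reduced group to the same word in
   FU_n, whose value there is c_i *)
rewrite gc -[RHS](padE (@FU_c n)) (flatE fu im) -fa; apply: multiplicative_flat.
move=> l li; have [j jl] := pad_surj (leq_ltn_trans li im).
by rewrite !(padP _ jl) fv jl /= (padP _ jl).
Qed.
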